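(* Let $n\ge2$ be an integer and let $g\colon [0,1]\to \mathbf{R}^{n-1}$ be Lipschitz. Then there is a set $X\subset [0,1]$ of Hausdorff dimension $1/2$ such that the set $\{(t,g(t))\colon t\in X\}\subset\mathbf{R}^n$ does not contain the three vertices of an isosceles triangle.
   Context: $\mathbf{R}^{n-1}$ and $\mathbf{R}^n=\mathbf{R}\times\mathbf{R}^{n-1}$ carry the Euclidean norm. *)

(* Defs.v *)
From HB Require Import structures.
From mathcomp Require Import all_boot all_order all_algebra.
From mathcomp Require Import all_classical all_reals all_analysis.
Set Implicit Arguments.
Unset Strict Implicit.
Unset Printing Implicit Defensive.
Import Order.TTheory GRing.Theory Num.Theory.
Import numFieldNormedType.Exports.
Local Open Scope classical_set_scope.
Local Open Scope ring_scope.

(* The norm provided by the library on 'rV[R]_m is the sup norm. *)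
Definition enorm (R : realType) (m : nat) (v : 'rV[R]_m) : R :=
  Num.sqrt (\sum_(i < m) v ord0 i ^+ 2).

Definition edist (R : realType) (m : nat) (p q : 'rV[R]_m) : R := enorm (p - q).

Definition elipschitz (R : realType) (m : nat) (A : set R) (g : R -> 'rV[R]_m)
    : Prop :=
  exists L : R, forall s t : R, A s -> A t -> edist (g s) (g t) <= L * `|s - t|.

Definition graph_point (R : realType) (m : nat) (g : R -> 'rV[R]_m) (t : R)
    : 'rV[R]_(1 + m) :=
  row_mx (t%:M : 'rV[R]_1) (g t).

(* Three distinct points with two equal distances: collinear (degenerate)
   triangles, i.e. three-term arithmetic progressions, are counted as well. *)
Definition isosceles (R : realType) (m : nat) (p q r : 'rV[R]_m) : Prop :=
  [/\ p <> q, q <> r & p <> r] /\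
  [\/ edist p q = edist p r, edist q p = edist q r | edist r p = edist r q].

(* Contains the vertices of no isosceles triangle. *)
Definition isosceles_free (R : realType) (m : nat) (E : set 'rV[R]_m) : Prop :=
  forall p q r : 'rV[R]_m, E p -> E q -> E r -> ~ isosceles p q r.

Local Open Scope ereal_scope.

(* The maximum with 0 is only relevant to the empty set. *)
Definition diam (R : realType) (U : set R) : \bar R :=
  maxe 0 (ereal_sup [set `|xy.1 - xy.2|%:E | xy in U `*` U]).

(* Empty pieces of a cover contribute 0, also for s = 0 (where 0 `^ 0 = 1). *)
Definition diam_pow (R : realType) (s : R) (U : set R) : \bar R :=
  if U == set0 then 0 else diam U `^ s.

Definition hausdorff_content (R : realType) (s delta : R) (E : set R)
    : \bar R :=
  ereal_inf [set \sum_(0 <= i <oo) diam_pow s (U i) |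
    U in [set U : nat -> set R |
            E `<=` \bigcup_i U i /\ forall i, diam (U i) <= delta%:E]].

Definition hausdorff_measure (R : realType) (s : R) (E : set R) : \bar R :=
  ereal_sup [set hausdorff_content s delta E |
    delta in [set delta : R | (0 < delta)%R]].

Definition hausdorff_dim (R : realType) (E : set R) : \bar R :=
  ereal_inf [set s%:E |
    s in [set s : R | (0 <= s)%R /\ hausdorff_measure s E = 0]].

(* Main.v *)
Require Import Defs.
From HB Require Import structures.
From mathcomp Require Import all_boot all_order all_algebra.
From mathcomp Require Import all_classical all_reals all_analysis.
From mathcomp Require Import zify ring lra.
Set Implicit Arguments.
Unset Strict Implicit.
Unset Printing Implicit Defensive.
Import Order.TTheory GRing.Theory Num.Theory.
Import numFieldNormedType.Exports.
Local Open Scope classical_set_scope.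
Local Open Scope ring_scope.

(** The graph is a Lipschitz curve G which is not closed up, since its first
    coordinate is injective.  The theorem follows from two independent facts:
    on a large piece of the parameter interval the curve is almost a straight
    line run through at constant speed, and there the set X can be chosen so
    thin that three of its points are never even roughly equally spaced.

    Straightness.  Let C be the optimal Lipschitz constant of G, and let w be
    the vector of a chord over [a, a + l] whose slope exceeds k C, where
    k = 4/5 (exists_nearly_extremal_chord).  The function
    h t = <G t, w> - k |w| C t is larger at a + l than at a.  Replace it by
    its future minimum M t = inf of h over [t, a + l], as in the rising sun
    lemma.  M is nondecreasing and Lipschitz and increases in total, and at a
    point t near which M increases no later value of h is below h t
    (increase_point_future_min).  Hence for s < t with s such a point,
    <G t - G s, w> >= k |w| C (t - s), whereas |G t - G s| <= C (t - s): all
    chords between such points lie in a narrow cone around w and have nearly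
    the same slope.  How many such points there are is measured by M itself.

    Thinness.  Cut [a, a + l] into quarters again and again, and keep from
    each interval that was kept two of its quarters, either the first and the
    third or the second and the fourth, whichever pair sees the larger
    increment of M.  The set X (cantor) consists of the points of increase of
    M that survive.  At level k there are 2^k intervals of length l / 4^k, so
    the dimension is at most 1/2 (cantor_dim_le).  The increment of M over
    the surviving intervals is at least halved at each level, so 2^k times it
    does not decrease with k, while 2^k times the increment over one interval
    is at most a multiple of the square root of its length; this mass
    distribution makes the dimension at least 1/2 (cover_mass,
    cantor_dim_ge).  If x < y < z are in X and are separated for the first
    time at some level, two of them lie in one kept quarter and the third in
    the other; a full quarter separates these, and inside one quarter the set
    spans at most three quarters of the length.  So one of y - x and z - y is
    at most 3/4 of the other (treelim_gaps).

    Conclusion.  For x < y < z in X the chords from G x to G y and from G y to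
    G z have a positive inner product by the cone condition, so the side from
    G x to G z is strictly the longest.  The two other sides have lengths
    within a factor 4/5 of C (y - x) and C (z - y), which differ by a factor
    of at least 4/3 > 5/4, so they are different too. *)

(** * A family of nested quarter intervals *)

Section Tree.
Variables (R : realType) (a l : R) (M : R -> R).

Definition gridpt (k n : nat) : R := a + l * n%:R / 4 ^+ k.

Definition gridmass (k n : nat) : R := M (gridpt k n.+1) - M (gridpt k n).

(** The quarters of the n-th interval of level k that are kept have numbers c
    and c + 2, where c is the offset; ties go to c = 0. *)
Definition offset (k n : nat) : nat :=
  if gridmass k.+1 (4 * n + 1) + gridmass k.+1 (4 * n + 3)
     <= gridmass k.+1 (4 * n) + gridmass k.+1 (4 * n + 2) then 0%N else 1%N.

(** The binary digits of i < 2 ^ k are the choices between the two kept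
    quarters, so i indexes the kept intervals of level k from left to right
    and i./2 is the index of the parent. *)
Fixpoint node (k i : nat) : nat :=
  if k is k'.+1 then
    (4 * node k' i./2 + offset k' (node k' i./2) + 2 * odd i)%N
  else i.

Definition cell (k i : nat) : set R :=
  `[gridpt k (node k i), gridpt k (node k i).+1].

Lemma offset_le1 k n : (offset k n <= 1)%N.
Proof. by rewrite /offset; case: ifP. Qed.

Lemma half_lt k i : (i < 2 ^ k.+1)%N -> (i./2 < 2 ^ k)%N.
Proof. by rewrite expnS; lia. Qed.

Lemma node_lt k i : (i < 2 ^ k)%N -> (node k i < 4 ^ k)%N.
Proof.
elim: k i => [|k IH] i ik /=; first by rewrite expn0 in ik *.
have := IH _ (half_lt ik); have := offset_le1 k (node k i./2).
rewrite (expnS 4); case: (odd i); lia.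
Qed.

(** Kept intervals of the same level are never adjacent: siblings are two steps
    apart by construction, and children inherit the gap of their parents. *)
Lemma node_gap k i j : (i < j)%N -> (j < 2 ^ k)%N -> (node k i + 2 <= node k j)%N.
Proof.
elim: k i j => [|k IH] i j ij jk /=; first by rewrite expn0 in jk; lia.
have oi := offset_le1 k (node k i./2); have oj := offset_le1 k (node k j./2).
have [hij|hij] := ltnP i./2 j./2.
  have := IH _ _ hij (half_lt jk); case: (odd i); case: (odd j); lia.
have E : i./2 = j./2 by lia.
rewrite E; have [-> ->] : odd i = false /\ odd j = true by lia.
lia.
Qed.

Hypothesis l0 : 0 < l.

Lemma gridpt_le k n m : (n <= m)%N -> gridpt k n <= gridpt k m.
Proof.
move=> nm; rewrite /gridpt lerD2l ler_pM2r ?invr_gt0 ?exprn_gt0//.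
by rewrite ler_pM2l// ler_nat.
Qed.

Lemma gridpt_refine k n : gridpt k.+1 (4 * n) = gridpt k n.
Proof. by rewrite /gridpt natrM exprS; field; apply: expf_neq0. Qed.

Lemma gridptD k n m : gridpt k (n + m) = gridpt k n + m%:R * (l / 4 ^+ k).
Proof. by rewrite /gridpt natrD; ring. Qed.

Lemma gridpt00 : gridpt 0 0 = a.
Proof. by rewrite /gridpt mulr0 mul0r addr0. Qed.

Lemma gridpt01 : gridpt 0 1 = a + l.
Proof. by rewrite /gridpt expr0; field. Qed.

Lemma gridpt_itv k n : (n <= 4 ^ k)%N -> a <= gridpt k n <= a + l.
Proof.
move=> nk; have k0 : 0 < (4 : R) ^+ k by rewrite exprn_gt0.
rewrite /gridpt lerDl lerD2l; apply/andP; split.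
  by rewrite divr_ge0 ?mulr_ge0 ?(ltW k0) ?(ltW l0).
by rewrite ler_pdivrMr// ler_pM2l// -natrX ler_nat.
Qed.

Lemma cell_sub k i : cell k.+1 i `<=` cell k i./2.
Proof.
move=> t; rewrite /cell /= !in_itv /= => /andP[h1 h2]; apply/andP; split.
  by apply: le_trans h1; rewrite -gridpt_refine gridpt_le//; lia.
apply: (le_trans h2); rewrite -(gridpt_refine k) gridpt_le//.
have := offset_le1 k (node k i./2); case: (odd i); lia.
Qed.

Lemma cell_itv k i t : (i < 2 ^ k)%N -> cell k i t -> a <= t <= a + l.
Proof.
move=> /node_lt ik; rewrite /cell /= in_itv /= => /andP[h1 h2].
have /andP[+ _] := @gridpt_itv k _ (ltnW ik).
have /andP[_ +] := @gridpt_itv k _ ik; lra.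
Qed.

Lemma cell_dist k i x y : cell k i x -> cell k i y -> `|x - y| <= l / 4 ^+ k.
Proof.
rewrite /cell /= !in_itv /= -addn1 gridptD mul1r => /andP[? ?] /andP[? ?].
rewrite ler_norml; lra.
Qed.

Lemma cell_gap k i j x y : (i < j)%N -> (j < 2 ^ k)%N -> cell k i x -> cell k j y ->
  l / 4 ^+ k <= y - x.
Proof.
move=> ij jk; rewrite /cell /= !in_itv /= => /andP[_ xi] /andP[yj _].
have := gridpt_le k (node_gap ij jk); rewrite addn2 -addn1 gridptD mul1r; lra.
Qed.

Lemma cell_width_gt0 k : 0 < l / 4 ^+ k.
Proof. by rewrite divr_gt0// exprn_gt0. Qed.

Lemma cell_inj k i j x y : (i < 2 ^ k)%N -> (j < 2 ^ k)%N ->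
  cell k i x -> cell k j y -> `|x - y| < l / 4 ^+ k -> i = j.
Proof.
move=> ik jk ix jy; rewrite ltr_norml => /andP[h1 h2].
case: (ssrnat.ltngtP i j) => // ij.
  by exfalso; have := cell_gap ij jk ix jy; lra.
by exfalso; have := cell_gap ij ik jy ix; lra.
Qed.

Lemma cell_uniq k i j x : (i < 2 ^ k)%N -> (j < 2 ^ k)%N ->
  cell k i x -> cell k j x -> i = j.
Proof.
move=> ik jk ix jx; apply: (cell_inj ik jk ix jx).
by rewrite subrr normr0 cell_width_gt0.
Qed.

(** Two siblings together span only three of the four quarters of their parent,
    whichever pair is kept. *)
Lemma cell_sibling k i j x y : i./2 = j./2 -> cell k.+1 i x -> cell k.+1 j y ->
  y - x <= 3 / 4 * (l / 4 ^+ k).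
Proof.
rewrite /cell /= !in_itv /= => -> /andP[xi _] /andP[_ yj].
set m := (4 * _ + _)%N in xi yj.
have : y <= gridpt k.+1 (m + 3) by apply: le_trans yj _; apply: gridpt_le; case: (odd j); lia.
have : gridpt k.+1 m <= x by apply: le_trans xi; apply: gridpt_le; lia.
rewrite gridptD exprS invfM; lra.
Qed.

Lemma cell_width_small (e : R) : 0 < e -> exists k, l / 4 ^+ k < e.
Proof.
move=> e0; have [n hn] : exists n, l / e < n%:R.
  by exists (Num.truncn (l / e)).+1; rewrite truncnS_gt.
exists n; rewrite ltr_pdivrMr ?exprn_gt0// mulrC -ltr_pdivrMr//.
apply: (lt_le_trans hn); rewrite -natrX ler_nat; exact: ltnW (ltn_expl _ _).
Qed.

Definition treelim : set R :=
  [set t | forall k, exists2 i, (i < 2 ^ k)%N & cell k i t].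

(** At the first level that separates x from z, the point y falls into the
    interval of x or into that of z.  The points in the same interval differ by
    at most 3/4 of its length, because they lie in two of its children, and the
    gap to the third point is at least its length. *)
Lemma treelim_gaps x y z : treelim x -> treelim y -> treelim z ->
  x < y -> y < z -> y - x <= 3 / 4 * (z - y) \/ z - y <= 3 / 4 * (y - x).
Proof.
move=> Tx Ty Tz xy yz; have xz := lt_trans xy yz.
pose split k := `[< ~ exists i, [/\ (i < 2 ^ k)%N, cell k i x & cell k i z] >].
have exs : exists k, split k.
  have [k hk] := @cell_width_small (z - x) ltac:(lra).
  exists k; apply/asboolP => -[i [ik ix iz]].
  by have := cell_dist iz ix; rewrite ger0_norm; lra.
have [k /asboolP sk mink] := ex_minnP exs.
case: k sk mink => [|k] sk mink.
  exfalso; apply: sk; exists 0%N; rewrite expn0; split => //.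
    by have [[|i]] := Tx 0%N; rewrite expn0.
  by have [[|i]] := Tz 0%N; rewrite expn0.
have [i [ik ix iz]] : exists i, [/\ (i < 2 ^ k)%N, cell k i x & cell k i z].
  apply/asboolP; apply: contrapT => ns.
  suff : (k.+1 <= k)%N by rewrite ltnn.
  by apply: mink; apply/asboolP => /asboolP.
have iy : cell k i y.
  move: ix iz; rewrite /cell /= !in_itv /= => /andP[? ?] /andP[? ?].
  apply/andP; lra.
have [jx jxk cx] := Tx k.+1; have [jy jyk cy] := Ty k.+1.
have [jz jzk cz] := Tz k.+1.
have ex := cell_uniq (half_lt jxk) ik (cell_sub cx) ix.
have ey := cell_uniq (half_lt jyk) ik (cell_sub cy) iy.
have ez := cell_uniq (half_lt jzk) ik (cell_sub cz) iz.
have nxz : jx <> jz by move=> e; apply: sk; exists jx; split => //; rewrite e.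
have close j t u : (j < 2 ^ k.+1)%N -> cell k.+1 j t -> cell k.+1 j u ->
    treelim t -> treelim u -> u - t <= 3 / 4 * (l / 4 ^+ k.+1).
  move=> jk jt ju Tt Tu.
  have [n nk ct] := Tt k.+2; have [n' nk' cu] := Tu k.+2.
  apply: (@cell_sibling k.+1 n n') => //.
  rewrite (cell_uniq (half_lt nk) jk (cell_sub ct) jt).
  by rewrite (cell_uniq (half_lt nk') jk (cell_sub cu) ju).
have [exy|nxy] := eqVneq jx jy.
  left; subst jy; have := close _ _ _ jxk cx cy Tx Ty.
  have [jxz|] := ltnP jx jz; first by have := cell_gap jxz jzk cy cz; lra.
  rewrite leq_eqVlt => /orP[/eqP e|jxz]; first by exfalso; apply: nxz.
  by have := cell_gap jxz jxk cz cx; have := cell_width_gt0 k.+1; lra.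
have eyz : jy = jz by lia.
right; subst jz; have := close _ _ _ jyk cy cz Ty Tz.
have [jxz|] := ltnP jx jy; first by have := cell_gap jxz jyk cx cy; lra.
rewrite leq_eqVlt => /orP[/eqP e|jxz]; first by exfalso; apply: nxz.
by have := cell_gap jxz jxk cz cx; have := cell_width_gt0 k.+1; lra.
Qed.

Variable K : R.
Hypothesis M_incr : forall p q, a <= p -> p <= q -> q <= a + l ->
  0 <= M q - M p <= K * (q - p).

(** The support of the measure with distribution function M. *)
Definition increase_point (t : R) : Prop := forall e, 0 < e ->
  exists p q, [/\ a <= p, p <= q & q <= a + l] /\
              [/\ `|p - t| < e, `|q - t| < e & M p < M q].

Definition cantor : set R := treelim `&` increase_point.

Lemma gridmass_bounds k n : (n < 4 ^ k)%N ->
  0 <= gridmass k n <= K * (l / 4 ^+ k).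
Proof.
move=> nk; have /andP[h1 _] := @gridpt_itv k _ (ltnW nk).
have /andP[_ h2] := @gridpt_itv k _ nk.
have := M_incr h1 (gridpt_le k (leqnSn n)) h2.
have -> : gridpt k n.+1 - gridpt k n = l / 4 ^+ k.
  by rewrite -addn1 gridptD mul1r; ring.
by [].
Qed.

(** The four quarters share the increment of M, and the heavier of the two
    admissible pairs is kept. *)
Lemma gridmass_children k i :
  gridmass k (node k i) <= 2 * (gridmass k.+1 (node k.+1 (2 * i)) +
                                gridmass k.+1 (node k.+1 (2 * i).+1)).
Proof.
set n := node k i.
have E : gridmass k n = gridmass k.+1 (4 * n) + gridmass k.+1 (4 * n + 1) +
    gridmass k.+1 (4 * n + 2) + gridmass k.+1 (4 * n + 3).
  rewrite /gridmass -(gridpt_refine k n) -(gridpt_refine k n.+1) mulnS (addnC 4%N).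
  by rewrite !addn1 !addn2 !addn3 !addn4; ring.
have -> : node k.+1 (2 * i) = (4 * n + offset k n)%N.
  rewrite /= (_ : (2 * i)./2 = i); last by lia.
  by rewrite (_ : odd (2 * i) = false) ?addn0//; lia.
have -> : node k.+1 (2 * i).+1 = (4 * n + offset k n + 2)%N.
  rewrite [LHS]/= (_ : uphalf (2 * i) = i); last by lia.
  by rewrite (_ : ~~ odd (2 * i) = true)//; lia.
rewrite E /offset; case: ifPn => [h|]; first by rewrite addn0; lra.
by rewrite -ltNge -addnA; lra.
Qed.

(** * The mass distribution principle *)

Section CoverMass.
Variables (U : nat -> set R) (j : nat -> nat).
Hypothesis UX : cantor `<=` \bigcup_n U n.
Hypothesis Uj : forall n x y, U n x -> U n y -> `|x - y| < l / 4 ^+ j n.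
Hypothesis K0 : 0 <= K.

(* By the gap between kept intervals, U n meets only one of them at each level
   up to j n.  It is charged to these intervals, which form a branch, with the
   largest value that 2 ^ k times the increment of M can take at level j n. *)
Let toll (k i n : nat) : \bar R :=
  (if `[< (k <= j n)%N /\ U n `&` cell k i !=set0 >] then K * l / 2 ^+ j n else 0)%:E.

Let cost (k i : nat) : \bar R := (\sum_(0 <= n <oo) toll k i n)%E.

Let light (k i : nat) : bool := (cost k i < (2 ^+ k * gridmass k (node k i))%:E)%E.

Let toll_pos n : 0 <= K * l / 2 ^+ j n.
Proof. by rewrite divr_ge0 ?mulr_ge0 ?exprn_ge0 ?(ltW l0). Qed.

Let toll_ge0 k i n : (0 <= toll k i n)%E.
Proof. by rewrite /toll lee_fin; case: ifP. Qed.

Let cost_children k i : (i < 2 ^ k)%N ->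
  (cost k.+1 (2 * i) + cost k.+1 (2 * i).+1 <= cost k i)%E.
Proof.
move=> ik; rewrite /cost -nneseriesD//; apply: lee_nneseries => n *.
  exact: adde_ge0.
rewrite /toll -EFinD lee_fin.
have sub c : (c./2 = i)%N -> (k.+1 <= j n)%N /\ U n `&` cell k.+1 c !=set0 ->
    (k <= j n)%N /\ U n `&` cell k i !=set0.
  move=> <- [kj [x [Ux cx]]]; split; first exact: ltnW.
  by exists x; split => //; exact: cell_sub.
have disj : (k.+1 <= j n)%N /\ U n `&` cell k.+1 (2 * i) !=set0 ->
    (k.+1 <= j n)%N /\ U n `&` cell k.+1 (2 * i).+1 !=set0 -> False.
  move=> [kj [x [Ux cx]]] [_ [y [Uy cy]]].
  suff : (2 * i = (2 * i).+1)%N by lia.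
  apply: (cell_inj _ _ cx cy); rewrite ?expnS; try lia.
  apply: (lt_le_trans (Uj Ux Uy)).
  by rewrite ler_pM2l// lef_pV2 ?posrE ?exprn_gt0// ler_eXn2l// ltr1n.
case: asboolP => h1; case: asboolP => h2; case: asboolP => h3;
  rewrite ?addr0 ?add0r //; exfalso.
- exact: disj h1 h2.
- exact: disj h1 h2.
- by apply: h3; apply: sub h1; lia.
- by apply: h3; apply: sub h2; lia.
Qed.

(* If neither child were light, the parent would not be light either, as 2 ^ k
   times the increment of M does not decrease from a parent to its two children
   together. *)
Let light_child k i : (i < 2 ^ k)%N -> light k i ->
  light k.+1 (2 * i) || light k.+1 (2 * i).+1.
Proof.
move=> ik; apply: contraTT; rewrite negb_or /light -!leNgt => /andP[h1 h2].
apply: (le_trans _ (cost_children ik)); apply: (le_trans _ (leeD h1 h2)).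
rewrite -EFinD lee_fin exprS -mulrDr mulrC [2 * _]mulrC -!mulrA mulrC.
rewrite ler_pM2l ?exprn_gt0//; exact: gridmass_children.
Qed.

Let Fixpoint path (k : nat) : nat :=
  if k is k'.+1 then
    if light k (2 * path k') then (2 * path k')%N else (2 * path k').+1
  else 0%N.

Let path_lt k : (path k < 2 ^ k)%N.
Proof. by elim: k => //= k IH; rewrite expnS; case: ifP; lia. Qed.

Let path_half k : (path k.+1)./2 = path k.
Proof. by rewrite /=; case: ifP; lia. Qed.

Let path_light : light 0 0 -> forall k, light k (path k).
Proof.
move=> h0; elim => //= k IH; have := light_child (path_lt k) IH.
by case: ifP => //= ->.
Qed.

Let path_point : exists t, forall k, cell k (path k) t.
Proof.
pose lo k := gridpt k (node k (path k)).
have nest k m t : cell (k + m) (path (k + m)) t -> cell k (path k) t.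
  elim: m => [|m IH]; rewrite ?addn0// addnS => /cell_sub.
  by rewrite path_half.
have in_lo k : cell k (path k) (lo k).
  by rewrite /cell /= in_itv /= lexx gridpt_le.
have lohi k m : lo m <= gridpt k (node k (path k)).+1.
  have [km|/ltnW mk] := leqP k m.
    have := nest k (m - k)%N (lo m); rewrite subnKC// => /(_ (in_lo m)).
    by rewrite /cell /= in_itv => /andP[].
  have := nest m (k - m)%N (lo k); rewrite subnKC// => /(_ (in_lo k)).
  rewrite /cell /= in_itv => /andP[h _]; apply: (le_trans h).
  exact: gridpt_le.
exists (sup (range lo)) => k; rewrite /cell /= in_itv /=; apply/andP; split.
  apply: ub_le_sup; last by exists k.
  by exists (gridpt 0 (node 0 (path 0)).+1) => _ [m _ <-].
by apply: ge_sup => [|_ [m _ <-]]; [exists (lo 0); exists 0%N|].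
Qed.

(** If the sum were smaller than the total increment of M, the root would be
    light, and one could descend for ever along light intervals.  They shrink
    to a point where M increases, hence to a point of some U n; but at level
    j n the toll of U n alone is too large for a light interval. *)
Lemma cover_mass : ((M (a + l) - M a)%:E <= \sum_(0 <= n <oo) (K * l / 2 ^+ j n)%:E)%E.
Proof.
rewrite leNgt; apply/negP => small.
have root : light 0 0.
  rewrite /light expr0 mul1r /gridmass gridpt00 gridpt01.
  apply: le_lt_trans small; apply: lee_nneseries => n *; first exact: toll_ge0.
  by rewrite /toll lee_fin; case: ifP.
have plight := path_light root.
have [t pt] := path_point.
have mass_gt0 k : 0 < gridmass k (node k (path k)).
  have : (0 < (2 ^+ k * gridmass k (node k (path k)))%:E)%E.
    by apply: le_lt_trans (plight k); apply: nneseries_ge0 => *; exact: toll_ge0.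
  by rewrite lte_fin pmulr_rgt0// exprn_gt0.
have tX : cantor t.
  split=> [k|e e0]; first by exists (path k).
  have [k ke] := cell_width_small e0.
  exists (gridpt k (node k (path k))), (gridpt k (node k (path k)).+1).
  have nk := node_lt (path_lt k).
  have /andP[? _] := @gridpt_itv k _ (ltnW nk).
  have /andP[_ ?] := @gridpt_itv k _ nk.
  have le_pt := gridpt_le k (leqnSn (node k (path k))).
  split; split => //.
  - apply: le_lt_trans ke; apply: (@cell_dist k (path k)); last exact: pt.
    by rewrite /cell /= in_itv /= lexx.
  - apply: le_lt_trans ke; apply: (@cell_dist k (path k)); last exact: pt.
    by rewrite /cell /= in_itv /= lexx andbT.
  - by rewrite -subr_gt0; exact: mass_gt0.
have [n _ Unt] := UX tX.
have := plight (j n); rewrite /light ltNge => /negP; apply.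
apply: (@le_trans _ _ (toll (j n) (path (j n)) n)).
  rewrite /toll asboolT; last by split => //; exists t.
  rewrite lee_fin.
  have /andP[_ mle] := gridmass_bounds (node_lt (path_lt (j n))).
  have p0 : 0 < (2 : R) ^+ j n by rewrite exprn_gt0.
  rewrite (_ : K * l / 2 ^+ j n = 2 ^+ j n * (K * (l / 4 ^+ j n))).
    by rewrite ler_pM2l.
  rewrite (_ : 4 = 2 * 2 :> R); last by ring.
  by rewrite exprMn; field; rewrite expf_neq0.
rewrite /cost (@nneseriesD1 _ _ n)// leeDl//; exact: nneseries_ge0.
Qed.

End CoverMass.
End Tree.

(** * Bounds for the Hausdorff dimension *)

Section Dimension.
Variable R : realType.
Implicit Types (s d : R) (U E : set R).
Local Open Scope ereal_scope.

Lemma diam_ge0 U : 0 <= diam U.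
Proof. by rewrite /diam le_max lexx. Qed.

Lemma dist_le_diam U x y : U x -> U y -> `|x - y|%:E <= diam U.
Proof.
move=> Ux Uy; rewrite /diam le_max; apply/orP; right.
by apply: ereal_sup_ubound; exists (x, y).
Qed.

Lemma diam_le U d : (0 <= d)%R -> (forall x y, U x -> U y -> (`|x - y| <= d)%R) ->
  diam U <= d%:E.
Proof.
move=> d0 Ud; rewrite /diam ge_max lee_fin d0/=.
by apply: ge_ereal_sup => _ [[x y] [/= Ux Uy] <-]; rewrite lee_fin Ud.
Qed.

Lemma diam_pow_ge0 s U : 0 <= diam_pow s U.
Proof. by rewrite /diam_pow; case: ifP => // _; exact: poweR_ge0. Qed.

Lemma hausdorff_content_ge0 s d E : 0 <= hausdorff_content s d E.
Proof.
apply: le_ereal_inf_tmp => _ [U _ <-].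
by apply: nneseries_ge0 => *; exact: diam_pow_ge0.
Qed.

Lemma hausdorff_content_le_cover s d E (N : nat) (V : nat -> set R) c :
  (0 < s)%R -> (0 <= c <= d)%R -> E `<=` \bigcup_(i < N) V i ->
  (forall i x y, (i < N)%N -> V i x -> V i y -> (`|x - y| <= c)%R) ->
  hausdorff_content s d E <= (N%:R * (c `^ s))%:E.
Proof.
move=> s0 /andP[c0 cd] EV Vc.
pose U i := if (i < N)%N then V i else set0.
have Uc i : diam (U i) <= c%:E.
  apply: diam_le => // x y; rewrite /U; case: ifP => // iN; exact: Vc.
apply: (@le_trans _ _ (\sum_(0 <= i <oo) diam_pow s (U i))).
  apply: ereal_inf_lbound; exists U => //; split.
    by move=> x /EV[i iN Vix]; exists i => //; rewrite /U iN.
  by move=> i; apply: (le_trans (Uc i)); rewrite lee_fin.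
rewrite (nneseries_split 0 N); last by move=> *; exact: diam_pow_ge0.
rewrite eseries0 ?adde0; last first.
  by move=> i Ni _; rewrite /diam_pow /U ltnNge Ni /= eqxx.
have -> : (N%:R * (c `^ s))%:E = \sum_(0 <= i < 0 + N) (c `^ s)%:E.
  by rewrite sumEFin big_const_nat iter_addr_0 add0n subn0 mulr_natl.
apply: lee_sum => i _; rewrite /diam_pow; case: ifP => _.
  by rewrite lee_fin powR_ge0.
rewrite -poweR_EFin; apply: gt0_ler_poweR; rewrite ?in_itv/= ?leey ?andbT ?lee_fin//.
- exact: ltW.
- exact: diam_ge0.
Qed.

Lemma hausdorff_dim_le E (t : R) : (0 <= t)%R ->
  (forall s, (t < s)%R -> hausdorff_measure s E = 0) -> hausdorff_dim E <= t%:E.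
Proof.
move=> t0 Et; apply/lee_addgt0Pr => e e0; apply: ereal_inf_lbound.
exists (t + e)%R => //; split; first by rewrite addr_ge0// ltW.
by apply: Et; rewrite ltrDl.
Qed.

Lemma geometric_small (A r e : R) : (0 <= r < 1)%R -> (0 < e)%R ->
  \forall k \near \oo, (A * r ^+ k < e)%R.
Proof.
move=> /andP[r0 r1] e0.
have /(_ A) := @cvg_geometric R ^~ r; rewrite ger0_norm// => /(_ r1) cv.
exact: (cvgr_lt _ cv).
Qed.

Lemma dyadic_scale (q r : R) : (0 < r < q)%R ->
  exists j, (q / 2 ^+ j.+1 <= r < q / 2 ^+ j)%R.
Proof.
move=> /andP[r0 rq]; have q0 := lt_trans r0 rq.
have ex : exists k, (q / 2 ^+ k <= r)%R.
  have half : (0 <= (2^-1 : R) < 1)%R by lra.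
  have [k _ /(_ k (leqnn k)) /ltW] := geometric_small q half r0.
  by rewrite exprVn; exists k.
have [[|k] kr mink] := ex_minnP ex.
  by move: kr; rewrite expr0 divr1 leNgt rq.
exists k; rewrite kr ltNge; apply/negP => /mink; by rewrite ltnn.
Qed.

End Dimension.

Section CantorDim.
Variables (R : realType) (a l : R) (M : R -> R).
Hypothesis l0 : 0 < l.

(** The 2 ^ k kept intervals of level k contribute (l / 4 ^ k) ^ s each, and
    2 * 4 ^ (- s) < 1 for s > 1/2. *)
Lemma cantor_dim_le : (hausdorff_dim (cantor a l M) <= (1 / 2)%:E)%E.
Proof.
apply: hausdorff_dim_le => [|s s12]; first by rewrite divr_ge0.
apply/eqP; rewrite eq_le; apply/andP; split; last first.
  apply: (@le_trans _ _ (hausdorff_content s 1 (cantor a l M))).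
    exact: hausdorff_content_ge0.
  by apply: ereal_sup_ubound; exists 1 => //=.
apply: ge_ereal_sup => _ [d /= d0 <-].
pose q : R := 4^-1; pose r := 2 * (q `^ s).
have r01 : 0 <= r < 1.
  rewrite /r mulr_ge0 ?powR_ge0//=.
  have -> : s = 2^-1 + (s - 2^-1) by field.
  rewrite powRD; last by rewrite invr_eq0 pnatr_eq0 implybT.
  rewrite powR12_sqrt ?invr_ge0// /q (_ : 4^-1 = (2^-1) ^+ 2 :> R); last by field.
  rewrite sqrtr_sqr ger0_norm ?invr_ge0// mulrA divff// mul1r.
  suff : (2^-1 ^+ 2 : R) `^ (s - 2^-1) < 1 `^ (s - 2^-1) by rewrite powR1.
  by apply: gt0_ltr_powR; rewrite ?nnegrE//; lra.
apply/lee_addgt0Pr => e e0; rewrite add0e.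
have q01 : 0 <= q < 1 by rewrite /q; lra.
have [k [kd ke]] : exists k, l * q ^+ k < d /\ l `^ s * r ^+ k < e.
  near \oo => k; exists k; split; near: k; exact: geometric_small.
apply: (@le_trans _ _ ((2 ^ k)%:R * ((l * q ^+ k) `^ s))%:E).
  apply: (@hausdorff_content_le_cover _ _ _ _ _ (cell a l M k)); first by lra.
  - by rewrite (ltW kd) andbT mulr_ge0 ?(ltW l0)// exprn_ge0//; lra.
  - by move=> t [/(_ k)[i ik ct] _]; exists i.
  - by move=> i x y _ cx cy; rewrite /q exprVn; exact: (cell_dist cx cy).
rewrite lee_fin; apply/ltW/le_lt_trans/ke.
have q0 : 0 <= q by lra.
rewrite powRM ?(ltW l0) ?exprn_ge0// -powR_mulrn// -powRrM mulrC powRrM.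
rewrite (powRAC q) powR_mulrn ?powR_ge0// /r exprMn natrX.
by rewrite -mulrA [X in _ * X <= _]mulrC.
Unshelve. all: by end_near. Qed.

Variable K : R.
Hypothesis M_incr : forall p q, a <= p -> p <= q -> q <= a + l ->
  0 <= M q - M p <= K * (q - p).
Hypothesis mass : M a < M (a + l).

(** A cover by sets of diameters d_n is turned into one to which the mass
    distribution principle applies by taking for j n the last level at which
    sqrt d_n is still below sqrt l / 2 ^ j n; then l / 2 ^ j n is comparable to
    sqrt d_n, and so bounded by a multiple of d_n ^ s for s < 1/2, d_n <= 1. *)
Lemma cantor_dim_ge : ((1 / 2)%:E <= hausdorff_dim (cantor a l M))%E.
Proof.
apply: le_ereal_inf_tmp => _ [s [s0 Hs] <-]; rewrite lee_fin leNgt.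
apply/negP => s12.
have al : a <= a + l by rewrite lerDl ltW.
have /andP[_ mK] := M_incr (lexx a) al (lexx _).
have K0 : 0 < K.
  by rewrite -(pmulr_lgt0 _ l0) (_ : l = a + l - a)//; [have := mass; lra | ring].
pose q := Num.sqrt l; have q0 : 0 < q by rewrite sqrtr_gt0.
have qq : q * q = l by rewrite -expr2 sqr_sqrtr// ltW.
pose m := M (a + l) - M a; have m0 : 0 < m by rewrite subr_gt0.
(* The first bound makes every r n smaller than q, so that a level exists; the
   second one makes the total 4 K q c of the tolls smaller than m. *)
pose c := Num.min (q / 2) (m / (8 * K * q)).
have Kq0 : 0 < 8 * K * q by rewrite !mulr_gt0.
have c0 : 0 < c by rewrite lt_min !divr_gt0.
have cq : 2 * c <= q by rewrite mulrC -ler_pdivlMr// ge_min lexx.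
have cm : c * (8 * K * q) <= m by rewrite -ler_pdivlMr// ge_min lexx orbT.
have : (hausdorff_content s 1 (cantor a l M) < c%:E)%E.
  apply: (@le_lt_trans _ _ 0%E); last by rewrite lte_fin.
  by rewrite -Hs; apply: ereal_sup_ubound; exists 1 => //=.
move=> /ereal_inf_lt[_ [U [UX U1] <-]] Uc.
have Ufin n : diam (U n) \is a fin_num.
  by rewrite ge0_fin_numE ?diam_ge0//; apply: le_lt_trans (U1 n) _; rewrite ltry.
have Upfin n : diam_pow s (U n) \is a fin_num.
  by rewrite /diam_pow; case: ifP => // _; exact: fin_num_poweR.
(* The geometric correction keeps r n positive for pieces of diameter 0, which
   would otherwise have no last level. *)
pose r n := fine (diam_pow s (U n)) + c / (2 ^ n.+1)%:R.
have cn0 n : 0 < c / (2 ^ n.+1)%:R by rewrite divr_gt0// ltr0n expn_gt0.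
have r0 n : 0 < r n by rewrite ltr_wpDl// fine_ge0// diam_pow_ge0.
have rsum : (\sum_(0 <= n <oo) (r n)%:E <= (2 * c)%:E)%E.
  rewrite (eq_eseriesr (g := fun n => diam_pow s (U n) + (c / (2 ^ n.+1)%:R)%:E)%E).
    apply: le_trans (epsilon_trick _ _ (ltW c0)) _ => [n|]; first exact: diam_pow_ge0.
    by rewrite mulr_natl mulr2n EFinD leeD2r// ltW.
  by move=> n _; rewrite EFinD fineK.
have rq n : r n < q.
  apply: lt_le_trans cq; rewrite -lte_fin; apply: lt_le_trans rsum.
  rewrite (@nneseriesD1 _ _ n)//=; last by move=> k _; rewrite lee_fin ltW.
  rewrite lteDl//; apply: (@lt_le_trans _ _ (r n.+1)%:E); first by rewrite lte_fin.
  rewrite (@nneseriesD1 _ _ n.+1)//=; last by rewrite gtn_eqF.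
    by rewrite leeDl// nneseries_ge0// => k _ _; rewrite lee_fin ltW.
  by move=> k _; rewrite lee_fin ltW.
have scale n : {j | q / 2 ^+ j.+1 <= r n < q / 2 ^+ j}.
  by apply: cid; apply: dyadic_scale; rewrite r0 rq.
pose j n := sval (scale n).
have jr n : q / 2 ^+ (j n).+1 <= r n < q / 2 ^+ j n := svalP (scale n).
have Uj n x y : U n x -> U n y -> `|x - y| < l / 4 ^+ j n.
  move=> Ux Uy; have dxy := dist_le_diam Ux Uy.
  have /andP[_ rj] := jr n.
  have lj : l / 4 ^+ j n = (q / 2 ^+ j n) ^+ 2.
    by rewrite expr_div_n expr2 qq -exprM mulnC exprM; congr (_ / _ ^+ _); ring.
  set d := fine (diam (U n)).
  have dE : diam (U n) = d%:E by rewrite fineK.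
  have xyd : `|x - y| <= d by rewrite -lee_fin -dE.
  have d0 : 0 <= d := le_trans (normr_ge0 _) xyd.
  have d1 : d <= 1 by rewrite -lee_fin -dE.
  apply: (le_lt_trans xyd); rewrite lj -(sqr_sqrtr d0) ltr_pXn2r ?nnegrE ?sqrtr_ge0//.
    apply: le_lt_trans rj; rewrite /r -[leLHS]addr0 lerD ?(ltW (cn0 n))//.
    rewrite /diam_pow ifF; last by apply/eqP => Un; rewrite Un in Ux.
    rewrite fine_poweR -/d -powR12_sqrt//.
    move: d0; rewrite le_eqVlt => /orP[/eqP <-|dp].
      by rewrite powR0 ?powR_ge0// invr_eq0.
    by apply: ger_powR; rewrite ?dp//; lra.
  by rewrite divr_ge0 ?(ltW q0)// exprn_ge0.
have := cover_mass l0 M_incr UX Uj (ltW K0); rewrite leNgt => /negP; apply.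
apply: (@le_lt_trans _ _ (\sum_(0 <= n <oo) (2 * K * q)%:E * (r n)%:E)%E).
  apply: lee_nneseries => n *; first by rewrite lee_fin divr_ge0 ?mulr_ge0 ?exprn_ge0 ?ltW.
  rewrite -EFinM lee_fin -qq.
  have /andP[jn _] := jr n.
  have -> : K * (q * q) / 2 ^+ j n = 2 * K * q * (q / 2 ^+ (j n).+1).
    by rewrite exprS; field; rewrite expf_neq0.
  by rewrite ler_pM2l ?mulr_gt0.
rewrite nneseriesZl; last by move=> n _; rewrite lee_fin ltW.
apply: (@le_lt_trans _ _ ((2 * K * q)%:E * (2 * c)%:E)%E).
  by apply: lee_wpmul2l => //; rewrite lee_fin !mulr_ge0 ?(ltW q0) ?(ltW K0).
by rewrite -EFinM lte_fin -/m; nra.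
Qed.

End CantorDim.

(** * The future minimum of a Lipschitz function *)

Section FutureMinimum.
Variables (R : realType) (a l K : R) (h : R -> R).
Hypotheses (l0 : 0 < l) (K0 : 0 <= K).
Hypothesis h_lip : forall p q, a <= p -> p <= q -> q <= a + l ->
  `|h q - h p| <= K * (q - p).

Definition future_min (t : R) : R := inf [set h s | s in `[t, a + l]].

Lemma future_min_le t s : a <= t -> t <= s -> s <= a + l -> future_min t <= h s.
Proof.
move=> at_ ts sl; apply: ge_inf; last by exists s => //; rewrite /= in_itv/= ts.
exists (h (a + l) - K * l) => _ [u /= + <-]; rewrite in_itv/= => /andP[tu ul].
have := h_lip (le_trans at_ tu) ul (lexx _); rewrite ler_norml => /andP[_].
have : K * (a + l - u) <= K * l by rewrite ler_wpM2l//; lra.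
lra.
Qed.

Lemma le_future_min t c : t <= a + l ->
  (forall s, t <= s -> s <= a + l -> c <= h s) -> c <= future_min t.
Proof.
move=> tl ch; apply: lb_le_inf.
  by exists (h (a + l)); exists (a + l) => //; rewrite /= in_itv/= tl lexx.
by move=> _ [u /= + <-]; rewrite in_itv/= => /andP[tu ul]; exact: ch.
Qed.

Lemma future_min_incr p q : a <= p -> p <= q -> q <= a + l ->
  0 <= future_min q - future_min p <= K * (q - p).
Proof.
move=> ap pq ql; apply/andP; split.
  rewrite subr_ge0; apply: le_future_min => // s qs sl.
  exact: future_min_le (le_trans pq qs) sl.
rewrite lerBlDl -lerBlDr; apply: le_future_min => [|s ps sl].
  exact: le_trans ql.
have [qs|/ltW sq] := leP q s.
  have := future_min_le (le_trans ap pq) qs sl.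
  have : 0 <= K * (q - p) by rewrite mulr_ge0// subr_ge0.
  lra.
have := future_min_le (le_trans ap pq) (lexx q) ql.
have := h_lip (le_trans ap ps) sq ql; rewrite ler_norml => /andP[_].
have : K * (q - s) <= K * (q - p) by rewrite ler_wpM2l//; lra.
lra.
Qed.

Lemma future_min_lt : h a < h (a + l) -> future_min a < future_min (a + l).
Proof.
move=> hh; have al : a <= a + l by rewrite lerDl ltW.
apply: (le_lt_trans (future_min_le (lexx a) (lexx a) al)).
apply: (lt_le_trans hh); apply: le_future_min => // s s1 s2.
by rewrite (_ : s = a + l)//; apply: le_anti; rewrite s1 s2.
Qed.

(** If h s < h t with s > t, then h stays above h s near t, so near t the
    infimum is determined by what happens from s on and M is constant. *)
Lemma increase_point_future_min t s : increase_point a l future_min t ->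
  a <= t -> t <= s -> s <= a + l -> h t <= h s.
Proof.
move=> It at_ ts sl; rewrite leNgt; apply/negP => hst.
have st : t < s.
  by rewrite lt_neqAle ts andbT; apply/eqP => e; rewrite e ltxx in hst.
pose e := Num.min (s - t) ((h t - h s) / (K + 1)).
have K1 : 0 < K + 1 by rewrite ltr_wpDl.
have e0 : 0 < e by rewrite lt_min divr_gt0 ?subr_gt0 ?st ?hst.
have est : e <= s - t by rewrite ge_min lexx.
have eK : e * (K + 1) <= h t - h s by rewrite -ler_pdivlMr// ge_min lexx orbT.
have [p [q [[ap pq ql] [pt qt Mpq]]]] := It e e0.
have qs : q <= s by move: qt; rewrite ltr_norml => /andP[]; lra.
have Mqs := future_min_le (le_trans ap pq) qs sl.
suff : future_min q <= future_min p by rewrite leNgt Mpq.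
apply: le_future_min => [|u pu ul]; first exact: le_trans ql.
have [qu|uq] := leP q u; first exact: future_min_le (le_trans ap pq) qu ul.
have ut : `|u - t| < e.
  move: pt qt; rewrite !ltr_norml => /andP[? ?] /andP[? ?]; apply/andP; lra.
have tl : t <= a + l := le_trans ts sl.
have : `|h t - h u| <= K * `|u - t|.
  have [tu|/ltW tu] := leP t u.
    by rewrite distrC [`|u - t|]ger0_norm ?subr_ge0//; exact: h_lip.
  by rewrite [`|u - t|]distrC [`|t - u|]ger0_norm ?subr_ge0//; apply: h_lip => //; lra.
have : K * `|u - t| <= K * e by rewrite ler_wpM2l// ltW.
rewrite ler_norml => ? /andP[_ ?]; lra.
Qed.

End FutureMinimum.

(** * Chords in a cone *)

Section Dot.
Variables (R : realType) (m : nat).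
Implicit Types u v w : 'rV[R]_m.

Definition dot u v : R := \sum_(i < m) u ord0 i * v ord0 i.

Lemma dotC u v : dot u v = dot v u.
Proof. by apply: eq_bigr => i _; rewrite mulrC. Qed.

Lemma dotDl u v w : dot (u + v) w = dot u w + dot v w.
Proof. by rewrite -big_split; apply: eq_bigr => i _; rewrite mxE mulrDl. Qed.

Lemma dotZl c u w : dot (c *: u) w = c * dot u w.
Proof. by rewrite mulr_sumr; apply: eq_bigr => i _; rewrite mxE mulrA. Qed.

Lemma dotDr u v w : dot w (u + v) = dot w u + dot w v.
Proof. by rewrite dotC dotDl !(dotC _ w). Qed.

Lemma dotZr c u w : dot w (c *: u) = c * dot w u.
Proof. by rewrite dotC dotZl dotC. Qed.

Lemma dotNr u w : dot w (- u) = - dot w u.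
Proof. by rewrite -scaleN1r dotZr mulN1r. Qed.

Lemma dot_ge0 u : 0 <= dot u u.
Proof. by apply: sumr_ge0 => i _; rewrite -expr2 sqr_ge0. Qed.

Lemma enorm_ge0 u : 0 <= enorm u.
Proof. exact: sqrtr_ge0. Qed.

Lemma enorm_sqr u : enorm u ^+ 2 = dot u u.
Proof. by rewrite /enorm (_ : \sum_(i < m) _ = dot u u) ?sqr_sqrtr ?dot_ge0. Qed.

Lemma dot_eq0 u : dot u u = 0 -> u = 0.
Proof.
move=> u0; apply/rowP => i; rewrite [RHS]mxE; apply/eqP; rewrite -sqrf_eq0 expr2.
apply/eqP; apply: (psumr_eq0P _ u0) => // k _; rewrite -expr2 sqr_ge0//.
Qed.

Lemma enorm_gt0 u : u != 0 -> 0 < enorm u.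
Proof.
move=> u0; rewrite lt_neqAle enorm_ge0 andbT eq_sym -sqrf_eq0 enorm_sqr.
by apply: contra u0 => /eqP/dot_eq0 ->.
Qed.

Lemma enorm0 : enorm (0 : 'rV[R]_m) = 0.
Proof. by rewrite /enorm big1 ?sqrtr0// => i _; rewrite mxE expr0n. Qed.

Lemma dot0r u : dot u 0 = 0.
Proof. by rewrite -[X in dot u X](subrr u) dotDr dotNr subrr. Qed.

Lemma cauchy_schwarz u v : dot u v ^+ 2 <= dot u u * dot v v.
Proof.
have [v0|v0] := ltP 0 (dot v v); last first.
  have -> : v = 0 by apply: dot_eq0; apply: le_anti; rewrite v0 dot_ge0.
  by rewrite !dot0r mulr0 expr0n.
have := dot_ge0 (dot v v *: u + (- dot u v) *: v).
rewrite !(dotDl, dotDr, dotZl, dotZr) (dotC v u) => ge0.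
rewrite -subr_ge0 -(pmulr_rge0 _ v0); apply: le_trans ge0 _.
rewrite le_eqVlt; apply/orP; left; apply/eqP; ring.
Qed.

Lemma dot_le_enorm u v : `|dot u v| <= enorm u * enorm v.
Proof.
rewrite -(@ler_pXn2r _ 2)// ?nnegrE ?mulr_ge0 ?enorm_ge0//.
by rewrite exprMn !enorm_sqr real_normK ?num_real// cauchy_schwarz.
Qed.

Lemma enorm_ltD u v : 0 < dot u v -> enorm u < enorm (u + v).
Proof.
move=> uv; rewrite -(@ltr_pXn2r _ 2)// ?nnegrE ?enorm_ge0// !enorm_sqr.
by rewrite !(dotDl, dotDr) (dotC v u); have := dot_ge0 v; lra.
Qed.

Lemma edistC u v : Defs.edist u v = Defs.edist v u.
Proof.
rewrite /Defs.edist /enorm; congr Num.sqrt; apply: eq_bigr => i _.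
by rewrite !mxE -[in RHS]sqrrN opprB.
Qed.

(** Rescaled to equal lengths, the sum of two vectors of a narrow cone is almost
    twice as long as either of them, so that the polarization identity makes
    their inner product positive. *)
Lemma cone_dot_gt0 (p q w : 'rV[R]_m) (x y L k : R) : 0 < x -> 0 < y -> 0 < L ->
  0 < enorm w -> 1 < 2 * k ^+ 2 -> 0 <= k ->
  enorm p <= L * x -> enorm q <= L * y ->
  k * enorm w * L * x <= dot p w -> k * enorm w * L * y <= dot q w ->
  0 < dot p q.
Proof.
move=> x0 y0 L0 w0 k1 k0 px qy pw qw.
have := cauchy_schwarz (y *: p + x *: q) w.
rewrite !(dotDl, dotDr, dotZl, dotZr) (dotC q p) -!enorm_sqr => cs.
have p2 : enorm p ^+ 2 <= (L * x) ^+ 2.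
  by rewrite ler_pXn2r ?nnegrE ?enorm_ge0// ?mulr_ge0 ?ltW.
have q2 : enorm q ^+ 2 <= (L * y) ^+ 2.
  by rewrite ler_pXn2r ?nnegrE ?enorm_ge0// ?mulr_ge0 ?ltW.
have lo : 2 * k * enorm w * L * (x * y) <= y * dot p w + x * dot q w.
  have := ler_wpM2l (ltW y0) pw; have := ler_wpM2l (ltW x0) qw; lra.
have lo2 : (2 * k * enorm w * L * (x * y)) ^+ 2 <= (y * dot p w + x * dot q w) ^+ 2.
  rewrite ler_pXn2r ?nnegrE//; last apply: le_trans lo.
    by rewrite !mulr_ge0 ?enorm_ge0// ltW.
  by rewrite !mulr_ge0 ?enorm_ge0// ltW.
have := le_trans lo2 cs.
rewrite (_ : (2 * k * enorm w * L * (x * y)) ^+ 2 =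
  ((2 * k * L * (x * y)) ^+ 2) * enorm w ^+ 2); last by ring.
rewrite ler_pM2r ?exprn_gt0// => main.
have P2 := ler_wpM2l (sqr_ge0 y) p2; have Q2 := ler_wpM2l (sqr_ge0 x) q2.
have xy0 : 0 < x * y by rewrite mulr_gt0.
have L2 : 0 < (L * (x * y)) ^+ 2 by rewrite exprn_gt0 ?mulr_gt0.
rewrite -(pmulr_rgt0 _ xy0).
have := mulr_gt0 L2 (_ : 0 < 2 * k ^+ 2 - 1); rewrite subr_gt0 => /(_ k1).
move: main P2 Q2; lra.
Qed.

End Dot.

(** * Curves and their graphs *)

Section Curve.
Variables (R : realType) (m : nat) (G : R -> 'rV[R]_m).

(** The constant C is the supremum of the slopes of all chords, which is positive
    because G 0 and G 1 differ. *)
Lemma exists_nearly_extremal_chord (L k : R) : G 0 != G 1 -> k < 1 ->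
  (forall s t, s \in `[0, 1] -> t \in `[0, 1] -> enorm (G t - G s) <= L * `|t - s|) ->
  exists C a l, [/\ 0 < C, 0 <= a, 0 < l & a + l <= 1] /\
    (forall s t, 0 <= s -> s <= t -> t <= 1 -> enorm (G t - G s) <= C * (t - s)) /\
    k * C * l < enorm (G (a + l) - G a).
Proof.
move=> G01 k1 GL.
pose S := [set c | exists a l, [/\ 0 <= a, 0 < l, a + l <= 1 &
  c = enorm (G (a + l) - G a) / l]].
have S1 : S (enorm (G 1 - G 0)) by exists 0, 1; rewrite add0r divr1.
have pos : 0 < enorm (G 1 - G 0) by rewrite enorm_gt0// subr_eq0 eq_sym.
have ubS : ubound S L.
  move=> _ [a [l [a0 l0 al ->]]]; rewrite ler_pdivrMr//.
  have := GL a (a + l); rewrite addrAC subrr add0r gtr0_norm//; apply.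
    by rewrite in_itv/= a0/=; lra.
  by rewrite in_itv/= al andbT; lra.
have supS : has_sup S by split; [eexists; exact: S1|exists L].
pose C := sup S.
have C0 : 0 < C by apply: lt_le_trans pos _; apply: ub_le_sup => //; case: supS.
have [_ [a [l [a0 l0 al ->]]]] := @sup_adherent _ S ((1 - k) * C)
  ltac:(by rewrite mulr_gt0// subr_gt0) supS.
rewrite -/C (_ : C - (1 - k) * C = k * C); last by ring.
rewrite ltr_pdivlMr// => steep.
exists C, a, l; split => //; split => // s t s0.
rewrite le_eqVlt => /orP[/eqP -> _|st t1].
  by rewrite !subrr mulr0 enorm0.
have ts : 0 < t - s by rewrite subr_gt0.
rewrite -ler_pdivrMr//; apply: ub_le_sup; first by case: supS.
have E : s + (t - s) = t by ring.
by exists s, (t - s); split => //; rewrite E.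
Qed.

(** The value k = 4/5 meets both needs: 2 k ^ 2 > 1 makes the angle between two
    chords acute, and k > 3/4 separates the two shorter sides. *)
Lemma exists_set_with_distinct_distances (L : R) : G 0 != G 1 ->
  (forall s t, s \in `[0, 1] -> t \in `[0, 1] -> enorm (G t - G s) <= L * `|t - s|) ->
  exists X : set R, [/\ X `<=` `[0, 1], hausdorff_dim X = (1 / 2)%:E &
    forall x y z, X x -> X y -> X z -> x < y -> y < z ->
      [/\ enorm (G y - G x) < enorm (G z - G x),
          enorm (G z - G y) < enorm (G z - G x) &
          enorm (G y - G x) <> enorm (G z - G y)]].
Proof.
move=> G01 GL; pose k : R := 4 / 5.
have k1 : k < 1 by rewrite /k; lra.
have k0 : 0 < k by rewrite /k; lra.
have [C [a [l [[C0 a0 l0 al] [GC steep]]]]] := exists_nearly_extremal_chord G01 k1 GL.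
set w := G (a + l) - G a in steep.
have w0 : 0 < enorm w by apply: le_lt_trans steep; rewrite !mulr_ge0 ?ltW.
pose h t := dot (G t) w - k * enorm w * C * t.
pose K := (1 + k) * (enorm w * C).
have wC0 : 0 < enorm w * C by rewrite mulr_gt0.
have K0 : 0 <= K by rewrite mulr_ge0 ?(ltW wC0)//; lra.
have hB s t : h t - h s = dot (G t - G s) w - k * enorm w * C * (t - s).
  by rewrite /h dotDl [dot (- _) _]dotC dotNr (dotC w); ring.
have h_lip p q : a <= p -> p <= q -> q <= a + l -> `|h q - h p| <= K * (q - p).
  move=> ap pq ql; have qp : 0 <= q - p by rewrite subr_ge0.
  have chord := GC _ _ (le_trans a0 ap) pq (le_trans ql al).
  have d1 := dot_le_enorm (G q - G p) w.
  have d2 : enorm (G q - G p) * enorm w <= C * (q - p) * enorm w.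
    by rewrite ler_pM2r.
  rewrite hB (le_trans (ler_normB _ _))// [`|k * _ * _ * _|]ger0_norm.
    by rewrite /K; lra.
  by rewrite !mulr_ge0 ?enorm_ge0 ?(ltW k0) ?(ltW C0).
have h_up : h a < h (a + l).
  rewrite -subr_gt0 hB -/w -enorm_sqr expr2 addrAC subrr add0r.
  by rewrite subr_gt0 (_ : k * enorm w * C * l = enorm w * (k * C * l)) ?ltr_pM2l//; ring.
pose M := future_min a l h.
have M_incr := @future_min_incr _ a l K h K0 h_lip.
have M_lt := @future_min_lt _ a l K h l0 K0 h_lip h_up.
exists (cantor a l M).
have X_itv x : cantor a l M x -> a <= x <= a + l.
  by move=> [/(_ 0%N)[i i0 ci] _]; exact: (cell_itv l0 i0 ci).
split.
- move=> x /X_itv; rewrite /= in_itv/= => /andP[? ?]; apply/andP; split; lra.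
- by apply/eqP; rewrite eq_le cantor_dim_le// (cantor_dim_ge l0 M_incr M_lt).
have cone x y : cantor a l M x -> cantor a l M y -> x <= y ->
    k * enorm w * C * (y - x) <= dot (G y - G x) w.
  move=> Xx Xy xy; have /andP[ax _] := X_itv _ Xx; have /andP[_ yl] := X_itv _ Xy.
  rewrite -subr_ge0 -hB subr_ge0.
  exact: (increase_point_future_min K0 h_lip Xx.2 ax xy yl).
have lip x y : cantor a l M x -> cantor a l M y -> x <= y ->
    enorm (G y - G x) <= C * (y - x).
  move=> /X_itv/andP[ax _] /X_itv/andP[_ yl] xy.
  by apply: GC => //; [exact: le_trans ax|exact: le_trans al].
have far x y : cantor a l M x -> cantor a l M y -> x <= y ->
    k * C * (y - x) <= enorm (G y - G x).
  move=> Xx Xy xy; rewrite -(ler_pM2r w0).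
  apply: le_trans (le_trans (ler_norm _) (dot_le_enorm _ _)).
  by apply: le_trans (cone _ _ Xx Xy xy); rewrite le_eqVlt; apply/orP; left; apply/eqP; ring.
move=> x y z Xx Xy Xz xy yz.
have xy0 : 0 < y - x by rewrite subr_gt0.
have yz0 : 0 < z - y by rewrite subr_gt0.
have pq : 0 < dot (G y - G x) (G z - G y).
  apply: (@cone_dot_gt0 _ _ _ _ w _ _ C k xy0 yz0 C0 w0).
  - by rewrite /k; lra.
  - exact: ltW.
  - by apply: lip => //; exact: ltW.
  - by apply: lip => //; exact: ltW.
  - by apply: cone => //; exact: ltW.
  - by apply: cone => //; exact: ltW.
have zx : G z - G x = (G y - G x) + (G z - G y) by rewrite [RHS]addrC addrA subrK.
split; first by rewrite zx enorm_ltD.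
  by rewrite zx [X in _ < enorm X]addrC enorm_ltD// dotC.
move=> e.
have := lip _ _ Xx Xy (ltW xy); have := lip _ _ Xy Xz (ltW yz).
have := far _ _ Xx Xy (ltW xy); have := far _ _ Xy Xz (ltW yz).
rewrite e => f1 f2 l1 l2.
have r1 : k * (z - y) <= y - x by rewrite -(ler_pM2l C0); lra.
have r2 : k * (y - x) <= z - y by rewrite -(ler_pM2l C0); lra.
have := treelim_gaps l0 Xx.1 Xy.1 Xz.1 xy yz; rewrite /k in r1 r2.
by case; lra.
Qed.

End Curve.

Lemma enorm_graph_sqr (R : realType) (m : nat) (g : R -> 'rV[R]_m) (s t : R) :
  enorm (graph_point g t - graph_point g s) ^+ 2 =
  (t - s) ^+ 2 + enorm (g t - g s) ^+ 2.
Proof.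
have first r : graph_point g r ord0 (lshift m ord0) = r.
  by rewrite row_mxEl mxE eqxx mulr1n.
have rest r i : graph_point g r ord0 (rshift 1 i) = g r ord0 i by rewrite row_mxEr.
have subE p (u v : 'rV[R]_p) i : (u - v) ord0 i = u ord0 i - v ord0 i by rewrite !mxE.
rewrite !enorm_sqr /dot big_split_ord big_ord1 subE !first expr2; congr (_ + _).
by apply: eq_bigr => i _; rewrite !subE !rest.
Qed.

Theorem theorem3 (R : realType) (n : nat) (hn : (2 <= n)%N)
    (g : R -> 'rV[R]_n.-1) (hg : elipschitz `[0, 1] g) :
  exists X : set R,
    [/\ X `<=` `[0, 1],
        hausdorff_dim X = (1 / 2)%:E
      & isosceles_free [set graph_point g t | t in X]].
Proof.
have [L gL] := hg; pose G := graph_point g.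
have G01 : G 0 != G 1.
  apply/eqP => e; have := enorm_graph_sqr g 0 1.
  rewrite -/G e subrr subr0 expr1n enorm_sqr (_ : dot _ _ = 0).
    by have := sqr_ge0 (enorm (g 1 - g 0)); lra.
  by rewrite /dot big1// => i _; rewrite mxE mul0r.
have GL s t : s \in `[0, 1] -> t \in `[0, 1] ->
    enorm (G t - G s) <= (1 + `|L|) * `|t - s|.
  move=> s01 t01; have := gL _ _ t01 s01; rewrite /Defs.edist => gts.
  have gts' : enorm (g t - g s) <= `|L| * `|t - s|.
    by apply: (le_trans gts); rewrite ler_wpM2r// ler_norm.
  rewrite -(@ler_pXn2r _ 2)// ?nnegrE ?enorm_ge0 ?mulr_ge0 ?addr_ge0//.
  rewrite enorm_graph_sqr mulrDl mul1r -[(t - s) ^+ 2]real_normK ?num_real//.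
  have := enorm_ge0 (g t - g s); have := normr_ge0 (t - s).
  by nra.
have [X [X01 dimX distX]] := exists_set_with_distinct_distances G01 GL.
exists X; split=> // _ _ _ [x Xx <-] [y Xy <-] [z Xz <-]; rewrite -/G.
have neq s t : G s <> G t -> s != t by move=> st; apply/eqP => e; apply: st; rewrite e.
have dE s t : Defs.edist (G s) (G t) = enorm (G t - G s) by rewrite edistC.
case=> -[/neq xy /neq yz /neq xz] ; rewrite !dE.
have sym s t : enorm (G s - G t) = enorm (G t - G s) := edistC (G s) (G t).
have key s t u : X s -> X t -> X u -> s < t -> t < u ->
    [/\ enorm (G t - G s) <> enorm (G u - G s), enorm (G u - G t) <> enorm (G u - G s)
      & enorm (G t - G s) <> enorm (G u - G t)].
  move=> Xs Xt Xu st tu; have [d1 d2 d3] := distX _ _ _ Xs Xt Xu st tu.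
  by split=> // e; [move: d1|move: d2]; rewrite e ltxx.
have [lxy|lyx|exy] := ltgtP x y; last by rewrite exy eqxx in xy.
all: have [lyz|lzy|eyz] := ltgtP y z; last by rewrite eyz eqxx in yz.
all: have [lxz|lzx|exz] := ltgtP x z; last by rewrite exz eqxx in xz.
- move: (key _ _ _ Xx Xy Xz lxy lyz).
  by rewrite ?(sym x y) ?(sym x z) ?(sym y z) => -[k1 k2 k3] []; congruence.
- by move: (lt_trans lxy (lt_trans lyz lzx)); rewrite ltxx.
- move: (key _ _ _ Xx Xz Xy lxz lzy).
  by rewrite ?(sym x y) ?(sym x z) ?(sym y z) => -[k1 k2 k3] []; congruence.
- move: (key _ _ _ Xz Xx Xy lzx lxy).
  by rewrite ?(sym x y) ?(sym x z) ?(sym y z) => -[k1 k2 k3] []; congruence.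
- move: (key _ _ _ Xy Xx Xz lyx lxz).
  by rewrite ?(sym x y) ?(sym x z) ?(sym y z) => -[k1 k2 k3] []; congruence.
- move: (key _ _ _ Xy Xz Xx lyz lzx).
  by rewrite ?(sym x y) ?(sym x z) ?(sym y z) => -[k1 k2 k3] []; congruence.
- by move: (lt_trans lyx (lt_trans lxz lzy)); rewrite ltxx.
- move: (key _ _ _ Xz Xy Xx lzy lyx).
  by rewrite ?(sym x y) ?(sym x z) ?(sym y z) => -[k1 k2 k3] []; congruence.
Qed.
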